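(* Let $\lambda\in\mathbb{R}$. For every integer $n\ge 0$ and every real $x>0$, \[ \Big(x^{1-\lambda}\frac{d}{dx}\Big)^{n}e^{x}=\sum_{k=0}^{\infty}\frac{(k)_{n,\lambda}}{k!}x^{k-n\lambda}=x^{-n\lambda}\,\mathrm{Bel}_{n,\lambda}(x)\,e^{x}, \] where $\big(x^{1-\lambda}\frac{d}{dx}\big)^n$ denotes the $n$-fold iterate of the operator $f\mapsto x^{1-\lambda}f'$.
   Context: For $\lambda\in\mathbb{R}$, $(x)_{0,\lambda}=1$ and $(x)_{n,\lambda}=x(x-\lambda)\cdots(x-(n-1)\lambda)$ for $n\ge1$. The degenerate exponential is $e_\lambda(t)=\sum_{k\ge0}(1)_{k,\lambda}t^k/k!$ (equal to $(1+\lambda t)^{1/\lambda}$ for $\lambda\ne0$, $e^t$ for $\lambda=0$). The degenerate Bell polynomials are defined by $e^{x(e_{\lambda}(t)-1)}=\sum_{n=0}^{\infty}\mathrm{Bel}_{n,\lambda}(x)\frac{t^{n}}{n!}$. *)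

(* Defs.v *)
(* Stdlib reals with Coquelicot. *)
From Stdlib Require Import Reals Factorial.
From Coquelicot Require Import Coquelicot.
Open Scope R_scope.

Fixpoint dfalling (lam x : R) (n : nat) : R :=
  match n with
  | O => 1
  | S m => dfalling lam x m * (x - INR m * lam)
  end.

(* The series converges for all t if lam = 0 and for |t| < 1/|lam| otherwise;
   outside its domain of convergence the value of PSeries is meaningless, so
   dexp is only ever used for t near 0. *)
Definition dexp (lam t : R) : R :=
  PSeries (fun k => dfalling lam 1 k / INR (fact k)) t.

(* Generating function exp (x (e_lam(t) - 1)) = sum_n Bel_n(x) t^n / n!, read as
   a convergent expansion for t near 0, the neighbourhood depending on x.  The
   left-hand side is analytic in t at 0, so such a family exists, and by
   uniqueness of power series coefficients it is unique. *)
Definition is_degenerate_Bell (lam : R) (Bel : nat -> R -> R) : Prop :=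
  forall x : R, locally 0 (fun t : R =>
    is_pseries (fun n => Bel n x / INR (fact n)) t
      (exp (x * (dexp lam t - 1)))).

(* Only meant on x > 0, where Rpower x y is the real power of x.  Derive is a
   local operation, so iterates at positive points depend only on the values at
   positive points. *)
Definition xD (lam : R) (f : R -> R) : R -> R :=
  fun x => Rpower x (1 - lam) * Derive f x.

(* Main.v *)
(* Put [S_n u = sum_k (k)_{n,lam} u^k / k!].  Since [(k)_{n+1,lam} =
   (k - n lam) (k)_{n,lam}], these entire functions satisfy
   [S_{n+1} u = u S_n' u - n lam S_n u] with [S_0 = exp].  The same recurrence
   governs both sides: [x^{- n lam} S_n x] is the n-th iterate of
   [x^{1-lam} d/dx] on [exp], and, because [(1 + lam t) e_lam' = e_lam], the
   n-th t-derivative of [exp (x (e_lam t - 1))] is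
   [exp (-x) S_n (x e_lam t) / (1 + lam t)^n] near 0.  At [t = 0] the latter is
   [Bel_n x = exp (-x) S_n x], with no double series to rearrange. *)
Require Import Defs.
From Stdlib Require Import Reals Factorial Lra.
From Coquelicot Require Import Coquelicot.
Open Scope R_scope.

(** The terms of a convergent series tend to 0, which fails strictly outside the disk of
    convergence. *)
Lemma CV_radius_ge_ex_pseries (a : nat -> R) (t : R) :
  ex_pseries a t -> Rbar_le (Rabs t) (CV_radius a).
Proof.
intros [l Hl].
apply Rbar_not_lt_le; intros Hlt.
apply (CV_disk_outside a t Hlt).
assert (Hs : ex_series (fun k => a k * t ^ k)).
{ exists l; apply is_series_ext with (2 := Hl); intros k.
  rewrite pow_n_pow; apply Rmult_comm. }
exact (ex_series_lim_0 _ Hs).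
Qed.

Lemma entire_lt_CV_radius (a : nat -> R) (u : R) :
  (forall v : R, ex_pseries a v) -> Rbar_lt (Rabs u) (CV_radius a).
Proof.
intros Ha.
apply Rbar_lt_le_trans with (2 := CV_radius_ge_ex_pseries a (Rabs u + 1) (Ha _)).
simpl; rewrite (Rabs_pos_eq (Rabs u + 1)); pose proof (Rabs_pos u); lra.
Qed.

(** Multiplying coefficients by [p k + q] is applying the operator [p t d/dt + q]. Both recurrences
    used below are instances: [(- lam, 1)] for [dexp_coef] and [(1, - n lam)] for
    [dobinski_coef]. *)
Lemma is_pseries_euler (a : nat -> R) (p q t : R) :
  Rbar_lt (Rabs t) (CV_radius a) ->
  is_pseries (fun k => (p * INR k + q) * a k) t
    (p * (t * PSeries (PS_derive a) t) + q * PSeries a t).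
Proof.
intros Ht.
assert (H1 : is_pseries (PS_scal p (PS_incr_1 (PS_derive a))) t
               (p * (t * PSeries (PS_derive a) t))).
{ apply (is_pseries_scal (V := R_NormedModule) p _ t (t * _));
    [apply Rmult_comm|].
  apply (is_pseries_incr_1 (V := R_NormedModule)).
  apply PSeries_correct, ex_pseries_derive, Ht. }
assert (H2 : is_pseries (PS_scal q a) t (q * PSeries a t)).
{ apply (is_pseries_scal (V := R_NormedModule) q _ t (PSeries a t));
    [apply Rmult_comm|].
  apply PSeries_correct, CV_radius_inside, Ht. }
apply is_pseries_ext with (2 := is_pseries_plus _ _ _ _ _ H1 H2).
intros [|k]; unfold PS_plus, PS_scal, PS_incr_1, PS_derive.
- change (p * 0 + q * a O = (p * INR 0 + q) * a O); simpl; ring.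
- change (p * (INR (S k) * a (S k)) + q * a (S k)
          = (p * INR (S k) + q) * a (S k)); ring.
Qed.

Definition dexp_coef (lam : R) (k : nat) : R :=
  dfalling lam 1 k / INR (fact k).

Lemma dexp_coef_S (lam : R) (k : nat) :
  INR (S k) * dexp_coef lam (S k) = (- lam * INR k + 1) * dexp_coef lam k.
Proof.
unfold dexp_coef; rewrite fact_simpl, mult_INR; simpl dfalling.
field; split; [apply INR_fact_neq_0 | apply not_0_INR; discriminate].
Qed.

(** By the recurrence, each step multiplies by [(1 - k lam) / (k + 1)], at most [1 + |lam|] in
    absolute value. This crude bound gives a positive radius of convergence. *)
Lemma dexp_coef_bound (lam : R) (k : nat) :
  Rabs (dexp_coef lam k) <= (1 + Rabs lam) ^ k.
Proof.
induction k as [|k IH].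
- unfold dexp_coef; simpl; rewrite Rabs_pos_eq; lra.
- pose proof (pos_INR k) as Hk; pose proof (Rabs_pos lam) as Hl.
  assert (HS : 0 < INR (S k)) by (rewrite S_INR; lra).
  apply Rmult_le_reg_l with (1 := HS).
  rewrite <- (Rabs_pos_eq (INR (S k))) at 1 by lra.
  rewrite <- Rabs_mult, dexp_coef_S, Rabs_mult.
  replace (INR (S k) * (1 + Rabs lam) ^ S k)
    with ((INR (S k) * (1 + Rabs lam)) * (1 + Rabs lam) ^ k) by (simpl; ring).
  apply Rmult_le_compat; [apply Rabs_pos | apply Rabs_pos | | exact IH].
  apply Rle_trans with (1 := Rabs_triang _ _).
  rewrite Rabs_mult, Rabs_Ropp, (Rabs_pos_eq (INR k)), Rabs_R1, S_INR by lra.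
  nra.
Qed.

Lemma dexp_CV_radius (lam : R) : Rbar_lt 0 (CV_radius (dexp_coef lam)).
Proof.
pose proof (Rabs_pos lam) as Hl.
assert (Hr : 0 < / (1 + Rabs lam)) by (apply Rinv_0_lt_compat; lra).
apply Rbar_lt_le_trans with (/ (1 + Rabs lam)); [exact Hr|].
apply (proj1 (CV_radius_bounded (dexp_coef lam))).
exists 1; intros k.
rewrite Rabs_mult, (Rabs_pos_eq (_ ^ k)) by (apply pow_le; lra).
rewrite pow_inv.
apply Rmult_le_reg_r with ((1 + Rabs lam) ^ k); [apply pow_lt; lra|].
rewrite Rmult_assoc, Rinv_l, Rmult_1_r, Rmult_1_l
  by (apply pow_nonzero; lra).
apply dexp_coef_bound.
Qed.

Lemma is_derive_dexp (lam t : R) :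
  Rbar_lt (Rabs t) (CV_radius (dexp_coef lam)) -> 0 < 1 + lam * t ->
  is_derive (dexp lam) t (dexp lam t / (1 + lam * t)).
Proof.
intros Ht Hpos.
(* The coefficient recurrence summed up: [e' = - lam t e' + e], to be solved for [e']. *)
assert (E : PSeries (PS_derive (dexp_coef lam)) t
            = - lam * (t * PSeries (PS_derive (dexp_coef lam)) t)
              + 1 * dexp lam t).
{ etransitivity;
    [| exact (is_pseries_unique _ _ _ (is_pseries_euler _ (- lam) 1 t Ht))].
  apply PSeries_ext; intros k; apply dexp_coef_S. }
replace (dexp lam t / (1 + lam * t))
  with (PSeries (PS_derive (dexp_coef lam)) t).
- exact (is_derive_PSeries _ _ Ht).
- apply Rmult_eq_reg_r with (1 + lam * t); [|lra].
  unfold Rdiv; rewrite Rmult_assoc, Rinv_l by lra; lra.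
Qed.

Lemma dexp_0 (lam : R) : dexp lam 0 = 1.
Proof. unfold dexp; rewrite PSeries_0; simpl; field. Qed.

Definition dobinski_coef (lam : R) (n k : nat) : R :=
  dfalling lam (INR k) n / INR (fact k).

Lemma dobinski_coef_0 (lam : R) (k : nat) : / INR (fact k) = dobinski_coef lam 0 k.
Proof. unfold dobinski_coef, Rdiv; simpl dfalling; ring. Qed.

Lemma dobinski_coef_S (lam : R) (n k : nat) :
  (1 * INR k + - (INR n * lam)) * dobinski_coef lam n k = dobinski_coef lam (S n) k.
Proof. unfold dobinski_coef, Rdiv; simpl dfalling; ring. Qed.

(** Starting from [exp], each step in [n] applies an operator [u d/du - n lam], which keeps a series
    convergent everywhere. *)
Lemma ex_pseries_dobinski (lam : R) (n : nat) (u : R) :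
  ex_pseries (dobinski_coef lam n) u.
Proof.
revert u; induction n as [|n IH]; intros u.
- exists (exp u); apply is_pseries_ext with (2 := is_exp_Reals u).
  apply dobinski_coef_0.
- eexists; eapply is_pseries_ext; [intros k; apply dobinski_coef_S|].
  apply is_pseries_euler, entire_lt_CV_radius, IH.
Qed.

(* The [S_n] above; for [lam = 0] this is Dobinski's series for [Bel_n u * exp u]. *)
Definition dobinski (lam : R) (n : nat) : R -> R := PSeries (dobinski_coef lam n).

Lemma dobinski_0 (lam u : R) : dobinski lam 0 u = exp u.
Proof.
rewrite exp_Reals; apply PSeries_ext; intros k; symmetry; apply dobinski_coef_0.
Qed.

Lemma ex_derive_dobinski (lam : R) (n : nat) (u : R) : ex_derive (dobinski lam n) u.
Proof.
apply ex_derive_PSeries, entire_lt_CV_radius, ex_pseries_dobinski.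
Qed.

Lemma dobinski_S (lam : R) (n : nat) (u : R) :
  dobinski lam (S n) u = u * Derive (dobinski lam n) u - INR n * lam * dobinski lam n u.
Proof.
assert (Hu : Rbar_lt (Rabs u) (CV_radius (dobinski_coef lam n)))
  by (apply entire_lt_CV_radius, ex_pseries_dobinski).
unfold dobinski at 2; rewrite Derive_PSeries by exact Hu.
transitivity (1 * (u * PSeries (PS_derive (dobinski_coef lam n)) u)
              + - (INR n * lam) * dobinski lam n u); [|ring].
apply is_pseries_unique.
eapply is_pseries_ext; [intros k; apply dobinski_coef_S|].
exact (is_pseries_euler _ _ _ _ Hu).
Qed.

Lemma iter_xD_exp (lam : R) (n : nat) (x : R) :
  0 < x ->
  Nat.iter n (xD lam) exp x = Rpower x (- (INR n * lam)) * dobinski lam n x.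
Proof.
revert x; induction n as [|n IH]; intros x hx.
- simpl; rewrite dobinski_0, Rmult_0_l, Ropp_0, Rpower_O by exact hx; ring.
- change (Rpower x (1 - lam) * Derive (Nat.iter n (xD lam) exp) x
          = Rpower x (- (INR (S n) * lam)) * dobinski lam (S n) x).
  set (c := - (INR n * lam)).
  assert (HP : is_derive (fun y => Rpower y c) x (c * Rpower x (c - 1)))
    by (apply is_derive_Reals, derivable_pt_lim_power, hx).
  (* The induction hypothesis covers only positive points, but these form a neighbourhood of [x]. *)
  rewrite (Derive_ext_loc _ (fun y => Rpower y c * dobinski lam n y)).
  2:{ apply filter_imp with (2 := open_gt 0 x hx); exact IH. }
  rewrite Derive_mult by
    (try (eexists; exact HP); apply ex_derive_dobinski).
  replace (Derive (fun y => Rpower y c) x) with (c * Rpower x (c - 1))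
    by (symmetry; exact (is_derive_unique _ _ _ HP)).
  rewrite dobinski_S.
  (* Both terms of the product rule now share the factor [Rpower x (c - 1)], leaving
     [x S_n' + c S_n], which is [S_{n+1}]. *)
  replace (Rpower x c) with (x * Rpower x (c - 1)).
  2:{ rewrite <- (Rpower_1 x hx) at 1; rewrite <- Rpower_plus; f_equal; ring. }
  replace (- (INR (S n) * lam)) with ((1 - lam) + (c - 1))
    by (unfold c; rewrite S_INR; ring).
  rewrite Rpower_plus; unfold c; ring.
Qed.

(** Stated near 0 rather than at 0 only, since the induction differentiates the formula. With
    [u = x e_lam t] one has [u' = u / (1 + lam t)], so the derivative of [S_n u / (1 + lam t)^n] is
    [(u S_n' u - n lam S_n u) / (1 + lam t)^(n+1)]. *)
Lemma Derive_n_Bell_gf (lam x : R) (n : nat) :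
  locally 0 (fun t : R =>
    Derive_n (fun s => exp (x * (dexp lam s - 1))) n t
    = exp (- x) * (dobinski lam n (x * dexp lam t) / (1 + lam * t) ^ n)).
Proof.
assert (HU : locally 0 (fun t : R =>
  Rbar_lt (Rabs t) (CV_radius (dexp_coef lam)) /\ 0 < 1 + lam * t)).
{ apply filter_and.
  - assert (Hc : continuous Rabs 0) by apply continuous_Rabs.
    apply (Hc (fun y => Rbar_lt y (CV_radius (dexp_coef lam)))), open_Rbar_lt.
    rewrite Rabs_R0; apply dexp_CV_radius.
  - assert (Hc : continuous (fun t => 1 + lam * t) 0)
      by (apply (ex_derive_continuous (V := R_NormedModule)); auto_derive; exact I).
    apply (Hc (fun y => 0 < y)), open_gt; lra. }
induction n as [|n IH].
- apply filter_forall; intros t; simpl.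
  rewrite dobinski_0, Rdiv_1_r, <- exp_plus; f_equal; ring.
- apply filter_imp with
    (2 := filter_and _ _ HU (locally_locally _ _ IH)).
  intros t [[Ht Hpos] Hloc]; simpl Derive_n.
  rewrite (Derive_ext_loc _ _ _ Hloc).
  pose proof (is_derive_dexp lam t Ht Hpos) as HE.
  apply is_derive_unique.
  auto_derive.
  + repeat split; try (eexists; exact HE); try apply ex_derive_dobinski.
    apply pow_nonzero; lra.
  + replace (Derive (fun s => dexp lam s) t) with (dexp lam t / (1 + lam * t))
      by (symmetry; exact (is_derive_unique _ _ _ HE)).
    rewrite dobinski_S.
    replace (Derive (fun s => dobinski lam n s) (x * dexp lam t))
      with (Derive (dobinski lam n) (x * dexp lam t)) by reflexivity.
    (* Differentiating the power produces the exponent [pred n], so [n = 0] is treated apart. *)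
    destruct n as [|n].
    * simpl; field; lra.
    * simpl Init.Nat.pred; simpl pow; rewrite ?S_INR.
      field; split; [apply pow_nonzero|]; lra.
Qed.

(** Both sides are the [n]-th derivative at 0 of the generating function. *)
Lemma Bell_eq_dobinski (lam : R) (Bel : nat -> R -> R) (n : nat) (x : R) :
  is_degenerate_Bell lam Bel -> Bel n x = exp (- x) * dobinski lam n x.
Proof.
intros hBel.
set (b := fun k => Bel k x / INR (fact k)).
(* Convergence at one nonzero point, [eps / 2], suffices. *)
assert (Hr : Rbar_lt 0 (CV_radius b)).
{ destruct (hBel x) as [eps Heps].
  pose proof (cond_pos eps) as He.
  apply Rbar_lt_le_trans with (Rabs (eps / 2)).
  - simpl; rewrite Rabs_pos_eq; lra.
  - apply CV_radius_ge_ex_pseries; eexists; apply Heps.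
    change (Rabs (eps / 2 - 0) < eps); rewrite Rabs_pos_eq; lra. }
assert (HD : Derive_n (fun t => exp (x * (dexp lam t - 1))) n 0
             = b n * INR (fact n)).
{ rewrite <- (Derive_n_coef b n Hr); apply Derive_n_ext_loc.
  apply filter_imp with (2 := hBel x); intros t Ht.
  symmetry; apply is_pseries_unique, Ht. }
rewrite (locally_singleton _ _ (Derive_n_Bell_gf lam x n)) in HD.
rewrite dexp_0, Rmult_0_r, Rplus_0_r, pow1, Rmult_1_r, Rdiv_1_r in HD.
rewrite HD; unfold b; field; apply INR_fact_neq_0.
Qed.

Theorem theorem3 (lam : R) (Bel : nat -> R -> R)
    (hBel : is_degenerate_Bell lam Bel) (n : nat) (x : R) (hx : 0 < x) :
  let a := fun k : nat =>
    dfalling lam (INR k) n / INR (fact k) * Rpower x (INR k - INR n * lam) in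
  is_series a (Nat.iter n (xD lam) exp x) /\
  Series a = Rpower x (- (INR n * lam)) * Bel n x * exp x.
Proof.
intros a.
(* The series of [S_n x] scaled by [x^(- n lam)]; as [x > 0], the powers [x ^ k] and
   [Rpower x (INR k)] agree. *)
assert (Ha : is_series a (Rpower x (- (INR n * lam)) * dobinski lam n x)).
{ apply is_series_ext with
    (2 := is_series_scal (Rpower x (- (INR n * lam))) _ _
            (PSeries_correct _ _ (ex_pseries_dobinski lam n x))).
  intros k; rewrite pow_n_pow.
  change (Rpower x (- (INR n * lam)) * (x ^ k * dobinski_coef lam n k) = a k).
  unfold a, Rminus; rewrite Rpower_plus, Rpower_pow by exact hx.
  unfold dobinski_coef; ring. }
split.
- rewrite iter_xD_exp by exact hx; exact Ha.
- rewrite (is_series_unique _ _ Ha), (Bell_eq_dobinski lam Bel n x hBel), exp_Ropp.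
  field; apply Rgt_not_eq, exp_pos.
Qed.
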